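(* Let $D$ be the center of an $A_3^8(1)$-polytope in $4_{21}$. Then $3D+4K_{S_8}$ is a skew $8$-line of $S_8$ if and only if the $A_3^8(1)$-polytope is uncornered.
   Context: $S_8$ is a del Pezzo surface obtained by blowing up $\mathbb{P}^2$ at $8$ points (with $-K_{S_8}$ ample). $\mathrm{Pic}\,S_8=\mathbb{Z}h\oplus\mathbb{Z}e_1\oplus\dots\oplus\mathbb{Z}e_8$ with intersection form $h^2=1$, $h\cdot e_i=0$, $e_i\cdot e_j=-\delta_{ij}$, and $K_{S_8}=-3h+\sum_{i=1}^8 e_i$. A line is a class $l\in\mathrm{Pic}\,S_8$ with $l^2=l\cdot K_{S_8}=-1$; $L_8$ is the set of lines, which is the vertex set of the Gosset polytope $4_{21}$ (the convex hull of $L_8$). A skew $a$-line is a class of the form $l_1+\dots+l_a$ with $l_1,\dots,l_a\in L_8$ distinct and $l_i\cdot l_j=0$ for $i\ne j$. An $A_n^8(1)$-polytope in $4_{21}$ is a set of $n+1$ distinct lines in $L_8$ with pairwise intersection number $1$; its center is the sum of these lines. The vertex figure of $l\in L_8$ is $\{l'\in L_8: l'\cdot l=0\}$. An $A_n^8(1)$-polytope is cornered if there is a line $l\in L_8$ whose vertex figure contains all its lines, and uncornered otherwise. *)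

(* Defs.v *)
From mathcomp Require Import all_boot all_order all_algebra.
From mathcomp Require Export finmap.

Set Implicit Arguments.
Unset Strict Implicit.
Unset Printing Implicit Defensive.

Import GRing.Theory.
Local Open Scope ring_scope.

(* The Picard lattice of the blow-up of P^2 at 8 points does not depend on the
   points, so the surface itself is not represented. The row vector D stands for
   D 0 0 *: h + \sum_i D 0 (rshift 1 i) *: e i  (lemma pic_basis). *)
Definition Pic := 'rV[int]_(1 + 8).

Definition h : Pic := delta_mx 0 (lshift 8 0).
Definition e (i : 'I_8) : Pic := delta_mx 0 (rshift 1 i).

Definition inter (D E : Pic) : int :=
  D 0 (lshift 8 0) * E 0 (lshift 8 0)
  - \sum_(i < 8) D 0 (rshift 1 i) * E 0 (rshift 1 i).

Definition K : Pic := - 3 *: h + \sum_(i < 8) e i.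

Definition L8 : {pred Pic} :=
  [pred l : Pic | (inter l l == -1) && (inter l K == -1)].

(* A finite set of lines stands for the polytope of which it is the vertex set;
   an {fset} has no repetitions, so its cardinal counts distinct lines. *)
Definition center (A : {fset Pic}) : Pic := \sum_(l <- A) l.

Definition skew_line (a : nat) (D : Pic) : Prop :=
  exists A : {fset Pic},
    [/\ #|` A| = a,
        {subset A <= L8},
        {in A &, forall l l', l != l' -> inter l l' = 0}
      & D = \sum_(l <- A) l].

Definition A_polytope (n : nat) (A : {fset Pic}) : Prop :=
  [/\ #|` A| = n.+1,
      {subset A <= L8}
    & {in A &, forall l l', l != l' -> inter l l' = 1}].

Definition vertex_figure (l : Pic) : {pred Pic} :=
  [pred l' : Pic | (l' \in L8) && (inter l' l == 0)].

Definition cornered (A : {fset Pic}) : Prop :=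
  exists2 l, l \in L8 & {subset A <= vertex_figure l}.

Definition uncornered (A : {fset Pic}) : Prop := ~ cornered A.

Lemma pic_basis (D : Pic) :
  D = D 0 (lshift 8 0) *: h + \sum_(i < 8) D 0 (rshift 1 i) *: e i.
Proof.
by rewrite {1}[D]row_sum_delta big_split_ord /= big_ord_recl big_ord0 addr0.
Qed.

Lemma inter_hh : inter h h = 1.
Proof.
by rewrite /inter big1 ?subr0 => [|i _]; rewrite !mxE ?eqxx ?mulr1.
Qed.

Lemma inter_he i : inter h (e i) = 0.
Proof.
rewrite /inter big1 => [|j _]; rewrite !mxE ?eq_lrshift ?eq_rlshift ?mulr0 //.
by rewrite mul0r.
Qed.

Lemma inter_ee i j : inter (e i) (e j) = - (i == j)%:R.
Proof.
rewrite /inter !mxE !eq_lrshift mulr0 sub0r; congr (- _).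
rewrite (bigD1 i) //= big1 => [|k ki]; rewrite !mxE !eq_rshift ?eqxx ?addr0 ?mul1r //.
by rewrite (negbTE ki) mul0r.
Qed.

(* Main.v *)
Require Import Defs.
From mathcomp Require Import all_boot all_order all_algebra.
From mathcomp Require Import zify ring.
Import Order.TTheory GRing.Theory Num.Theory.

(** Adding [K] identifies the lines with the roots of the E8 lattice, which is
    the orthogonal complement of [K] with the opposite form: two lines meet
    [1 - (r, r')] times when [r] and [r'] are their roots.  The
    estimates below all come from this lattice being positive definite
    ([inter_self_le0], [inter_self_eq0]) and even ([inter_parity]).

    Let [a], [b], [c], [d] be the four lines, i.e. four orthogonal roots, and let
    [D] be their sum.

    If a line [l] is disjoint from all four, then [D + 2 K - 2 l] is orthogonal
    to [K] and has square zero, so that [D = 2 l - 2 K].  Every class then meets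
    [3 D] in an even number, whereas a line of a skew 8-line meets the sum of
    that skew 8-line in [-1].  Hence [3 D + 4 K] is not a skew 8-line.

    Conversely, put [F = a + b + c].  In root terms [F + 3 K] has norm 6, and
    such a vector is congruent modulo 2 to a root ([congruent_line]).  Half of
    the difference of the two is again a root, with inner product 3 with
    [F + 3 K] ([half_difference_line]), which says that there is a line [y]
    disjoint from [a], [b] and [c].  Then [t = F + K - y] is another such line,
    and [y.d + t.d = 2].  If no line is disjoint from all four, then
    [y.d = t.d = 1] ([lines_disjoint_from_triple]).  Omitting each of the four
    lines in turn gives eight lines, whose sum is [3 D + 4 K].

    These eight lines are orthogonal to [H = D + K], for which [H.H = 1] and
    [H.K = -3] as for the class of a line of the plane; two distinct lines
    orthogonal to such a class are disjoint ([orthogonal_lines_disjoint]), in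
    the same way as two exceptional curves of one blow-down to the plane. *)

Set Implicit Arguments.
Unset Strict Implicit.
Unset Printing Implicit Defensive.

Local Open Scope ring_scope.

Local Notation deg D := (D 0 (lshift 8 0)).
Local Notation mul D i := (D 0 (rshift 1 i)).

(** * The intersection form *)

Lemma interC D E : inter D E = inter E D.
Proof.
rewrite /inter mulrC; congr (_ - _).
by apply: eq_bigr => i _; rewrite mulrC.
Qed.

Lemma interDl D E G : inter (D + E) G = inter D G + inter E G.
Proof.
rewrite /inter !mxE mulrDl.
under eq_bigr do rewrite mxE mulrDl.
by rewrite big_split /= opprD addrACA.
Qed.

Lemma interZl c D G : inter (c *: D) G = c * inter D G.
Proof.
rewrite /inter !mxE mulrBr mulr_sumr mulrA; congr (_ - _).
by apply: eq_bigr => i _; rewrite mxE mulrA.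
Qed.

Lemma interNl D G : inter (- D) G = - inter D G.
Proof. by rewrite -scaleN1r interZl mulN1r. Qed.

Lemma interDr G D E : inter G (D + E) = inter G D + inter G E.
Proof. by rewrite interC interDl !(interC G). Qed.

Lemma interZr c G D : inter G (c *: D) = c * inter G D.
Proof. by rewrite interC interZl (interC G). Qed.

Lemma interNr G D : inter G (- D) = - inter G D.
Proof. by rewrite interC interNl (interC G). Qed.

Definition interE := (interDl, interDr, interZl, interZr, interNl, interNr).

Lemma inter_suml I (r : seq I) (P : pred I) (F : I -> Pic) G :
  inter (\sum_(i <- r | P i) F i) G = \sum_(i <- r | P i) inter (F i) G.
Proof.
apply: (big_morph (inter^~ G) (fun D E => interDl D E G)).
by rewrite -(scale0r G) interZl mul0r.
Qed.

Lemma deg_K : deg K = - 3.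
Proof.
rewrite !mxE summxE big1 ?addr0 ?eqxx ?mulr1 // => i _.
by rewrite !mxE eq_lrshift.
Qed.

Lemma mul_K i : mul K i = 1.
Proof.
rewrite !mxE summxE eq_rlshift mulr0 add0r (bigD1 i) //= big1 ?addr0 => [|j ji].
  by rewrite !mxE eqxx eqxx.
by rewrite !mxE eqxx eq_rshift eq_sym (negbTE ji).
Qed.

Lemma inter_K D : inter D K = - 3 * deg D - \sum_(i < 8) mul D i.
Proof.
rewrite /inter deg_K mulrC; congr (_ - _).
by apply: eq_bigr => i _; rewrite mul_K mulr1.
Qed.

Lemma inter_KK : inter K K = 1.
Proof.
rewrite inter_K deg_K; under eq_bigr do rewrite mul_K.
by rewrite sumr_const card_ord.
Qed.

Lemma pic_eq (D E : Pic) : deg D = deg E -> (forall i, mul D i = mul E i) -> D = E.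
Proof.
move=> hd hm; apply/rowP => j.
by rewrite -(splitK j); case: (split j) => i /=; rewrite ?(ord1 i).
Qed.

(** * Negativity and parity *)

(** The nonnegative quantity is the sum of the squares of [8 m_i + 3 d], with [d]
    the degree of [v] and [m_i] its other coordinates: it measures how far the
    [m_i] are from being equal, given that their sum is [- 3 d]. *)
Lemma inter_self_le v : inter v K = 0 ->
  9 * inter v v <= - \sum_(i < 8) mul v i ^+ 2.
Proof.
rewrite inter_K => hK.
have : 0 <= \sum_(i < 8) (8 * mul v i + 3 * deg v) ^+ 2.
  by apply: sumr_ge0 => i _; apply: sqr_ge0.
have -> : \sum_(i < 8) (8 * mul v i + 3 * deg v) ^+ 2 =
  64 * (\sum_(i < 8) mul v i ^+ 2) + 48 * deg v * (\sum_(i < 8) mul v i)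
  + 72 * deg v ^+ 2.
  rewrite !mulr_sumr -big_split /=.
  have -> : 72 * deg v ^+ 2 = \sum_(i < 8) 9 * deg v ^+ 2.
    by rewrite sumr_const card_ord; ring.
  by rewrite -big_split /=; apply: eq_bigr => i _; ring.
have -> : \sum_(i < 8) mul v i = - 3 * deg v by lia.
rewrite /inter; under [in X in _ -> X]eq_bigr do rewrite -expr2.
set q := \sum_(i < 8) _; rewrite -expr2; lia.
Qed.

Lemma inter_self_le0 v : inter v K = 0 -> inter v v <= 0.
Proof.
move=> /inter_self_le.
have : 0 <= \sum_(i < 8) mul v i ^+ 2 by apply: sumr_ge0 => i _; apply: sqr_ge0.
lia.
Qed.

Lemma inter_self_eq0 v : inter v K = 0 -> inter v v = 0 -> v = 0.
Proof.
move=> hK h0; have := inter_self_le hK; rewrite h0 mulr0 oppr_ge0 => hq.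
have m0 i : mul v i = 0.
  have /eqP : \sum_(i < 8) mul v i ^+ 2 = 0.
    by apply: le_anti; rewrite hq sumr_ge0 // => j _; apply: sqr_ge0.
  rewrite psumr_eq0; last by move=> j _; apply: sqr_ge0.
  by move=> /allP /(_ i (mem_index_enum i)) /=; rewrite sqrf_eq0 => /eqP.
apply: pic_eq => [|i]; rewrite mxE //.
by move: hK; rewrite inter_K big1 => [|i _]; [lia | exact: m0].
Qed.

(** [K] is a characteristic vector, since [m * (m + 1)] is even. *)
Lemma inter_parity D : (2 %| inter D D + inter D K)%Z.
Proof.
have even2 (m : int) : (2 %| m * (m + 1))%Z.
  have : m = (m %/ 2)%Z * 2 \/ m = (m %/ 2)%Z * 2 + 1 by lia.
  set q := (m %/ 2)%Z; case=> ->.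
    by rewrite -mulrA mulrCA dvdz_mulr.
  by rewrite mulrC -addrA -[1 + 1]/(1 * 2 : int) -mulrDl -mulrA mulrCA dvdz_mulr.
have -> : inter D D + inter D K =
    deg D * (deg D + 1) - 2 * (2 * deg D) - \sum_(i < 8) mul D i * (mul D i + 1).
  rewrite inter_K /inter.
  under [in RHS]eq_bigr do rewrite mulrDr mulr1.
  by rewrite big_split /=; ring.
by rewrite !rpredB ?even2 ?dvdz_mulr // rpred_sum // => i _; apply: even2.
Qed.

(** * Lines *)

Lemma L8P l : reflect (inter l l = -1 /\ inter l K = -1) (l \in L8).
Proof. by rewrite inE; apply: (iffP andP) => -[/eqP ? /eqP ?]. Qed.

(** [K] is made a variable before expanding by bilinearity, because the rules
   would otherwise unfold it as the sum that defines it. *)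
Ltac inter_lia :=
  have := inter_KK;
  let k := fresh "k" in set (k := K) in *; clearbody k;
  rewrite ?interE; lia.

(** [E] is a tuple with the values of the remaining intersection numbers. *)
Ltac inter_eval E :=
  let k := fresh "k" in set (k := K) in *; clearbody k;
  rewrite ?interE ?E; ring.

(** The difference of two lines is orthogonal to [K], and its square is
    [- 2 - 2 l.l']. *)
Lemma line_inter_ge0 l l' : l \in L8 -> l' \in L8 -> l != l' -> 0 <= inter l l'.
Proof.
move=> /L8P[ll lK] /L8P[ll' lK'] /eqP ne.
have hK : inter (l - l') K = 0 by inter_lia.
have hs : inter (l - l') (l - l') = - 2 - 2 * inter l l'.
  by have := interC l l'; inter_lia.
have := inter_self_le0 hK; have : inter (l - l') (l - l') != 0.
  by apply/eqP => /(inter_self_eq0 hK)/eqP; rewrite subr_eq0 => /eqP.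
rewrite hs; lia.
Qed.

(** Negativity off [H] is read off from negativity off [K]: the combination of
    [l + l'] and [H] that is orthogonal to [K] has square [18 l.l' - 14], which
    leaves no room for [l.l' >= 1]. *)
Lemma orthogonal_lines_disjoint H l l' :
  inter H H = 1 -> inter H K = - 3 -> l \in L8 -> l' \in L8 ->
  inter H l = 0 -> inter H l' = 0 -> l != l' -> inter l l' = 0.
Proof.
move=> HH HK lL lL' Hl Hl' ne.
have ge0 := line_inter_ge0 lL lL' ne.
case/L8P: lL => ll lK; case/L8P: lL' => ll' lK'.
pose v : Pic := 3 *: (l + l') - 2 *: H.
have vK : inter v K = 0 by rewrite /v; inter_lia.
have vv : inter v v = 18 * inter l l' - 14.
  rewrite /v; have := interC l l'; have := interC H l; have := interC H l'.
  by inter_lia.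
have := inter_self_le0 vK; lia.
Qed.

(** In terms of the vector [x = F + 3 K] of norm 6 and the root [r = l + K], the
    classes [v = (x - r) / 2] and [w = (x + r) / 2] below lie in E8, hence have
    even norms; these norms add up to 4.  Neither vanishes, as [x] is not a
    multiple of [r], so both are roots, and [v] is the root of the line [Y].
    Then [(v, w) = 1], so that [(v, x) = 3], which is [Y.F = 0]. *)
Lemma half_difference_line F l Y : l \in L8 -> F = l + 2 *: Y ->
  inter F F = 3 -> inter F K = - 3 -> Y \in L8 /\ inter Y F = 0.
Proof.
move=> /L8P[ll lK] eF FF FK.
have YK : inter Y K = -1 by move: FK; rewrite eF; inter_lia.
have Yl : inter Y l = 1 - inter Y Y.
  by move: FF; rewrite eF; have := interC l Y; inter_lia.
have even := inter_parity Y.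
pose v := Y + K; pose w := Y + l + 2 *: K.
have vK : inter v K = 0 by rewrite /v; inter_lia.
have wK : inter w K = 0 by rewrite /w; inter_lia.
have vv : inter v v = inter Y Y - 1.
  by rewrite /v; have := interC K Y; inter_lia.
have ww : inter w w = - 3 - inter Y Y.
  rewrite /w; have := interC K Y; have := interC K l; have := interC l Y.
  by inter_lia.
have vl : inter v l = - inter Y Y.
  by rewrite /v; have := interC K l; inter_lia.
have wl : inter w l = - 2 - inter Y Y.
  by rewrite /w; have := interC K l; inter_lia.
have v0 : inter Y Y != 1.
  apply/eqP => h1; have v0 : v = 0 by apply: inter_self_eq0 => //; lia.
  by move: vl; rewrite v0 h1 -(scale0r v) interZl mul0r.
have w0 : inter Y Y != - 3.
  apply/eqP => h1; have w0 : w = 0 by apply: inter_self_eq0 => //; lia.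
  by move: wl; rewrite w0 h1 -(scale0r w) interZl mul0r.
have YY : inter Y Y = -1 by move: (inter_self_le0 vK) (inter_self_le0 wK); lia.
split; first by apply/L8P.
by rewrite eF; inter_lia.
Qed.

Lemma skew_line_orthogonal H (s : seq Pic) :
  inter H H = 1 -> inter H K = - 3 -> uniq s -> {subset s <= L8} ->
  {in s, forall l, inter H l = 0} -> skew_line (size s) (\sum_(l <- s) l).
Proof.
move=> HH HK us sL sH; exists [fset l in s]%fset; split.
- by rewrite card_fseq undup_id.
- by move=> l; rewrite in_fset => /sL.
- move=> l l'; rewrite !in_fset => ls ls'.
  by apply: (orthogonal_lines_disjoint HH HK); do ?[exact: sL | exact: sH].
- apply: perm_big; apply: uniq_perm; rewrite ?fset_uniq // => l.
  by rewrite in_fset.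
Qed.

(** * Lines modulo 2 *)

Lemma half_of_even_coords (D : Pic) :
  (2 %| deg D)%Z -> (forall i, (2 %| mul D i)%Z) -> exists Y, D = 2 *: Y.
Proof.
move=> hd hm; exists (\row_j (D ord0 j %/ 2)%Z).
by apply: pic_eq => [|i]; rewrite !mxE mulrC divzK.
Qed.

Lemma inter_e D i : inter D (e i) = - mul D i.
Proof.
rewrite {1}[D]pic_basis !interE inter_he mulr0 add0r inter_suml.
rewrite (bigD1 i) //= big1 => [|j ji].
  by rewrite interZl inter_ee eqxx addr0 mulrN1.
by rewrite interZl inter_ee (negbTE ji) oppr0 mulr0.
Qed.

Lemma e_K i : inter (e i) K = -1.
Proof. by rewrite interC inter_e mul_K. Qed.

Lemma e_L8 i : e i \in L8.
Proof. by apply/L8P; rewrite inter_ee eqxx e_K. Qed.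

(** The class of plane curves of degree [a] passing once through the points of
    [I]. *)
Definition plane_class (a : int) (I : {set 'I_8}) : Pic := a *: h - \sum_(i in I) e i.

Lemma deg_plane_class a I : deg (plane_class a I) = a.
Proof.
rewrite !mxE summxE big1 => [|i _]; first by rewrite eqxx oppr0 addr0 mulr1.
by rewrite !mxE eq_lrshift.
Qed.

Lemma mul_plane_class a I i : mul (plane_class a I) i = - (i \in I)%:R.
Proof.
rewrite !mxE summxE eq_rlshift mulr0 add0r; congr (- _).
have [iI|iI] := boolP (i \in I).
  rewrite (bigD1 i) //= big1 ?addr0 => [|j /andP[_ ji]].
    by rewrite !mxE !eqxx.
  by rewrite !mxE eqxx eq_rshift eq_sym (negbTE ji).
rewrite big1 // => j jI; rewrite !mxE eqxx eq_rshift.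
by case: eqP jI iI => [->|//] ->.
Qed.

Lemma card_sum_mem (I : {set 'I_8}) : #|I|%:R = \sum_(i < 8) (i \in I)%:R :> int.
Proof.
by rewrite -sum1_card natr_sum big_mkcond; apply: eq_bigr => i _; case: ifP.
Qed.

Lemma inter_plane_class a I :
  inter (plane_class a I) (plane_class a I) = a ^+ 2 - #|I|%:R.
Proof.
rewrite /inter deg_plane_class expr2; congr (_ - _).
rewrite card_sum_mem; apply: eq_bigr => i _.
by rewrite mul_plane_class; case: (i \in I).
Qed.

Lemma plane_class_K a I : inter (plane_class a I) K = - 3 * a + #|I|%:R.
Proof.
rewrite inter_K deg_plane_class card_sum_mem.
rewrite -sumrN; congr (_ + _); apply: eq_bigr => i _.
by rewrite mul_plane_class; case: (i \in I).
Qed.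

(** Let [I] be the set of the odd coordinates of [F] other than its degree.
    Squares being 0 or 1 modulo 4, the two hypotheses determine the size of [I]
    from the parity of the degree: 1 or 5 for an even degree, 2 or 6 for an odd
    one.  In each case there is a line with the same parities: an exceptional
    class, a conic through 5 points, a plane line through 2 points, or a cubic
    through 7 points with a double point at the one outside [I]. *)
Lemma congruent_line F : inter F F = 3 -> inter F K = - 3 ->
  exists l Y, l \in L8 /\ F = l + 2 *: Y.
Proof.
move=> FF FK; pose I := [set i | ~~ (2 %| mul F i)%Z].
have hI i : exists q, mul F i = (i \in I)%:R + 2 * q.
  exists (mul F i %/ 2)%Z; rewrite inE.
  by case: (boolP (2 %| mul F i)%Z) => /=; lia.
(* Parity of the number of odd coordinates, from [F.K]. *)
have sum2 : (2 %| \sum_(i < 8) mul F i - #|I|%:R)%Z.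
  rewrite card_sum_mem -sumrB rpred_sum // => i _.
  by have [q ->] := hI i; rewrite addrC addKr dvdz_mulr.
(* Residue modulo 4 of that number, from [F.F]. *)
have sum4 : (4 %| \sum_(i < 8) mul F i * mul F i - #|I|%:R)%Z.
  rewrite card_sum_mem -sumrB rpred_sum // => i _; have [q ->] := hI i.
  set b : int := (i \in I)%:R; have bb : b * b = b by rewrite /b; case: (i \in I).
  have -> : (b + 2 * q) * (b + 2 * q) - b = 4 * (q * b + q * q) + (b * b - b).
    by ring.
  by rewrite bb subrr addr0 dvdz_mulr.
have kle : (#|I| <= 8)%N by rewrite -[leqRHS]card_ord max_card.
move: FK FF; rewrite inter_K /inter => FK FF.
have [q dE] : exists q, deg F = 2 * q \/ deg F = 2 * q + 1.
  by exists (deg F %/ 2)%Z; lia.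
have ddE : deg F * deg F = 4 * (q * q) /\ deg F = 2 * q \/
           deg F * deg F = 4 * (q * q + q) + 1 /\ deg F = 2 * q + 1.
  by case: dE => ->; [left|right]; split=> //; ring.
have by_line a D : D \in L8 -> deg D = a -> (2 %| deg F - a)%Z ->
  (forall i, (2 %| mul D i - (i \in I)%:R)%Z) ->
  exists l Y, l \in L8 /\ F = l + 2 *: Y.
  move=> DL Da Fa hD; have [] := @half_of_even_coords (F - D).
  - by rewrite !mxE Da.
  - move=> i; rewrite !mxE; have [r ->] := hI i; have := hD i.
    set b : int := (_)%:R; set m := mul D i; lia.
  - by move=> Y /eqP; rewrite subr_eq addrC => /eqP ->; exists D, Y.
have cases : [\/ #|I| = 1%N /\ (2 %| deg F)%Z, #|I| = 2 /\ (2 %| deg F - 1)%Z,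
    #|I| = 5 /\ (2 %| deg F)%Z | #|I| = 6 /\ (2 %| deg F - 1)%Z].
  move: kle sum2 sum4 FK FF ddE; rewrite natz.
  move: (deg F) (deg F * deg F) (\sum_(i < 8) mul F i) => d dd S1.
  move: (\sum_(i < 8) _) #|I| => S2 k kle sum2 sum4 FK FF ddE.
  have : k = 1%N /\ (2 %| d)%Z \/ k = 2 /\ (2 %| d - 1)%Z \/
         k = 5 /\ (2 %| d)%Z \/ k = 6 /\ (2 %| d - 1)%Z by lia.
  by case=> [|[|[|]]]; [constructor 1|constructor 2|constructor 3|constructor 4].
have evenL a i : (2 %| mul (plane_class a I) i - (i \in I)%:R)%Z.
  by rewrite mul_plane_class; case: (i \in I).
case: cases => -[cardI dF].
- have /eqP/cards1P[j Ij] := cardI.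
  apply: (by_line 0 (e j)); rewrite ?e_L8 ?subr0 //.
    by rewrite mxE eq_lrshift.
  by move=> i; rewrite mxE eqxx eq_rshift Ij inE subrr.
- apply: (by_line 1 (plane_class 1 I)); rewrite ?deg_plane_class //.
  by apply/L8P; rewrite inter_plane_class plane_class_K cardI.
- apply: (by_line 2 (plane_class 2 I)); rewrite ?deg_plane_class //; last by lia.
  by apply/L8P; rewrite inter_plane_class plane_class_K cardI.
- (* Of the two even coordinates, either can carry the double point. *)
  have [j jI] : exists j, j \notin I.
    by apply/existsP; rewrite -negb_forall; apply/negP => /forallP hj;
    move: cardI; rewrite (eq_card (B := 'I_8)) ?card_ord.
  have jt : inter (plane_class 3 I) (e j) = 0.
    by rewrite inter_e mul_plane_class (negbTE jI).
  apply: (by_line 3 (plane_class 3 I - 2 *: e j)); last 1 first.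
  + move=> i; have := evenL 3 i; move: (plane_class 3 I) => t; rewrite !mxE.
    set m := mul t i; set b : int := (i \in I)%:R; lia.
  + have tt := inter_plane_class 3 I; have tK := plane_class_K 3 I.
    have jK := e_K j; have jj := inter_ee j j; have tj := interC (e j) (plane_class 3 I).
    move: (plane_class 3 I) jt tt tK tj => t; rewrite cardI eqxx in jj * => *.
    by apply/L8P; split; inter_lia.
  + have := deg_plane_class 3 I; move: (plane_class 3 I) => t dt.
    by rewrite !mxE dt eq_lrshift.
  + by lia.
Qed.

(** * Four lines meeting pairwise once *)

(** A line [y] with [y.(a + b + c) = 0] differs from [a], [b], [c], so it meets
    each of them nonnegatively, hence not at all.  The line
    [t = a + b + c + K - y] has the same property, and [y.d + t.d = 2] where
    neither number vanishes. *)
Lemma lines_disjoint_from_triple a b c d :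
  a \in L8 -> b \in L8 -> c \in L8 -> d \in L8 ->
  inter a b = 1 -> inter a c = 1 -> inter a d = 1 ->
  inter b c = 1 -> inter b d = 1 -> inter c d = 1 ->
  (forall l, l \in L8 -> inter a l = 0 -> inter b l = 0 -> inter c l = 0 ->
     inter d l <> 0) ->
  exists y t, [/\ y \in L8 /\ t \in L8,
    y + t = a + b + c + K, y != t,
    [/\ inter a y = 0, inter b y = 0, inter c y = 0 & inter d y = 1] &
    [/\ inter a t = 0, inter b t = 0, inter c t = 0 & inter d t = 1]].
Proof.
move=> aL bL cL dL ab ac ad bc bd cd unc.
have /L8P[aa aK] := aL; have /L8P[bb bK] := bL.
have /L8P[cc cK] := cL; have /L8P[dd dK] := dL.
have [ba ca cb] : [/\ inter b a = 1, inter c a = 1 & inter c b = 1].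
  by rewrite !(interC _ a) (interC c).
pose F : Pic := a + b + c.
have E := (inter_KK, (aa, bb, cc), (aK, bK, cK), (ab, ba, ac, ca, bc, cb)).
have FF : inter F F = 3 by rewrite /F; inter_eval E.
have FK : inter F K = - 3 by rewrite /F; inter_eval E.
have aF : inter a F = 1 by rewrite /F; inter_eval E.
have bF : inter b F = 1 by rewrite /F; inter_eval E.
have cF : inter c F = 1 by rewrite /F; inter_eval E.
have dF : inter d F = 3.
  by rewrite /F !interDr !(interC d) ad bd cd.
have [l [y0 [lL eF]]] := congruent_line FF FK.
have [yL yF] := half_difference_line lL eF FF FK.
move: y0 yL yF {eF l lL E} => y yL yF.
have /L8P[yy yK] := yL.
have a_y : a != y by apply/eqP => e; move: yF; rewrite -e aF.
have b_y : b != y by apply/eqP => e; move: yF; rewrite -e bF.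
have c_y : c != y by apply/eqP => e; move: yF; rewrite -e cF.
have [ay0 by0 cy0] : [/\ inter a y = 0, inter b y = 0 & inter c y = 0].
  move: (line_inter_ge0 aL yL a_y) (line_inter_ge0 bL yL b_y).
  move: (line_inter_ge0 cL yL c_y) yF; rewrite (interC y) /F !interDl; clear.
  by move=> *; split; lia.
pose t : Pic := F + K - y.
have [Fy Ky] : inter F y = 0 /\ inter K y = -1 by rewrite !(interC _ y).
have KF : inter K F = - 3 by rewrite interC.
have eF : F = a + b + c by [].
clearbody F.
have E := (inter_KK, (aK, bK, cK, dK, FK, yK, KF, Ky), (aF, bF, cF, dF, FF),
           (ay0, by0, cy0, yF, Fy, yy)).
have tL : t \in L8 by apply/L8P; rewrite /t; split; inter_eval E.
have at0 : inter a t = 0 by rewrite /t; inter_eval E.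
have bt0 : inter b t = 0 by rewrite /t; inter_eval E.
have ct0 : inter c t = 0 by rewrite /t; inter_eval E.
have dt : inter d t = 2 - inter d y by rewrite /t; inter_eval E.
have yt0 : inter y t = 0 by rewrite /t; inter_eval E.
have d_y : d != y by apply/eqP => e; move: ad; rewrite e ay0.
have d_t : d != t by apply/eqP => e; move: ad; rewrite e at0.
have y_t : y != t by apply/eqP => e; move: yt0; rewrite -e yy.
have := unc y yL ay0 by0 cy0; have := unc t tL at0 bt0 ct0.
have := line_inter_ge0 dL yL d_y; have := line_inter_ge0 dL tL d_t.
rewrite dt => ge1 ge2 ne1 ne2.
have dy1 : inter d y = 1 by clear -ge1 ge2 ne1 ne2; lia.
exists y, t; split=> //; first by rewrite -eF /t addrC subrK.
by rewrite dt dy1.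
Qed.

Lemma inter_center a b c d :
  a \in L8 -> b \in L8 -> c \in L8 -> d \in L8 ->
  inter a b = 1 -> inter a c = 1 -> inter a d = 1 ->
  inter b c = 1 -> inter b d = 1 -> inter c d = 1 ->
  inter (a + b + c + d) (a + b + c + d) = 8 /\ inter (a + b + c + d) K = - 4.
Proof.
move=> /L8P[aa aK] /L8P[bb bK] /L8P[cc cK] /L8P[dd dK] ab ac ad bc bd cd.
have [ba ca da] : [/\ inter b a = 1, inter c a = 1 & inter d a = 1].
  by rewrite !(interC _ a).
have [cb db dc] : [/\ inter c b = 1, inter d b = 1 & inter d c = 1].
  by rewrite !(interC _ b) (interC d).
have E := (aa, bb, cc, dd, (aK, bK, cK, dK), (ab, ac, ad, bc, bd, cd),
           (ba, ca, da, cb, db, dc)).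
by split; inter_eval E.
Qed.

(** The difference of the two sides is orthogonal to [K] and has square zero. *)
Lemma center_of_cornered D l : inter D D = 8 -> inter D K = - 4 ->
  l \in L8 -> inter D l = 0 -> D = 2 *: l - 2 *: K.
Proof.
move=> DD DK /L8P[ll lK] Dl; apply/eqP; rewrite -subr_eq0; apply/eqP.
have [Kl KD] : inter K l = -1 /\ inter K D = - 4 by rewrite !(interC K).
have lD : inter l D = 0 by rewrite interC.
have E := (inter_KK, DD, DK, KD, ll, lK, Kl, Dl, lD).
by apply: inter_self_eq0; inter_eval E.
Qed.

Lemma inter_skew_line_summand (B : {fset Pic}) m :
  {subset B <= L8} -> {in B &, forall l l', l != l' -> inter l l' = 0} ->
  m \in B -> inter m (\sum_(l <- B) l) = -1.
Proof.
move=> BL B0 mB; rewrite interC inter_suml.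
rewrite (bigD1_seq m) ?fset_uniq //= big1_seq => [|l /andP[ne lB]].
  by rewrite addr0; case/L8P: (BL m mB).
exact: B0.
Qed.

(** Omitting [x] among the four gives two lines with sum [D - x + K], where
    [D = a + b + c + d]; the four pairs add up to [3 D + 4 K]. *)
Lemma skew_line_center a b c d :
  a \in L8 -> b \in L8 -> c \in L8 -> d \in L8 ->
  inter a b = 1 -> inter a c = 1 -> inter a d = 1 ->
  inter b c = 1 -> inter b d = 1 -> inter c d = 1 ->
  (forall l, l \in L8 -> inter a l = 0 -> inter b l = 0 -> inter c l = 0 ->
     inter d l <> 0) ->
  skew_line 8 (3 *: (a + b + c + d) + 4 *: K).
Proof.
move=> aL bL cL dL ab ac ad bc bd cd unc.
have [DD DK] := inter_center aL bL cL dL ab ac ad bc bd cd.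
have [D eD] : exists D, D = a + b + c + d by exists (a + b + c + d).
rewrite -eD in DD DK *.
have [ba ca da] : [/\ inter b a = 1, inter c a = 1 & inter d a = 1].
  by rewrite !(interC _ a).
have [cb db dc] : [/\ inter c b = 1, inter d b = 1 & inter d c = 1].
  by rewrite !(interC _ b) (interC d).
have [y1 [t1 [[y1L t1L] e1 n1 [ay1 by1 cy1 dy1] [at1 bt1 ct1 dt1]]]] :=
  lines_disjoint_from_triple aL bL cL dL ab ac ad bc bd cd unc.
have [y2 [t2 [[y2L t2L] e2 n2 [by2 cy2 dy2 ay2] [bt2 ct2 dt2 at2]]]] :=
  lines_disjoint_from_triple bL cL dL aL bc bd ba cd ca da
    (fun l lL bl cl dl al => unc l lL al bl cl dl).
have [y3 [t3 [[y3L t3L] e3 n3 [cy3 dy3 ay3 by3] [ct3 dt3 at3 bt3]]]] :=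
  lines_disjoint_from_triple cL dL aL bL cd ca cb da db ab
    (fun l lL cl dl al bl => unc l lL al bl cl dl).
have [y4 [t4 [[y4L t4L] e4 n4 [dy4 ay4 by4 cy4] [dt4 at4 bt4 ct4]]]] :=
  lines_disjoint_from_triple dL aL bL cL da db dc ab ac bc
    (fun l lL dl al bl cl => unc l lL al bl cl dl).
pose H : Pic := D + K.
have KD : inter K D = - 4 by rewrite interC.
have E := (inter_KK, DD, DK, KD).
have HH : inter H H = 1 by rewrite /H; clear eD; inter_eval E.
have HK : inter H K = - 3 by rewrite /H; clear eD; inter_eval E.
(* Distinct omitted lines give distinct intersection numbers, which separates
   lines coming from different triples. *)
pose f x := (inter a x, inter b x, inter c x, inter d x).
have [fy1 ft1] : f y1 = (0, 0, 0, 1) /\ f t1 = (0, 0, 0, 1).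
  by rewrite /f ay1 by1 cy1 dy1 at1 bt1 ct1 dt1.
have [fy2 ft2] : f y2 = (1, 0, 0, 0) /\ f t2 = (1, 0, 0, 0).
  by rewrite /f ay2 by2 cy2 dy2 at2 bt2 ct2 dt2.
have [fy3 ft3] : f y3 = (0, 1, 0, 0) /\ f t3 = (0, 1, 0, 0).
  by rewrite /f ay3 by3 cy3 dy3 at3 bt3 ct3 dt3.
have [fy4 ft4] : f y4 = (0, 0, 1, 0) /\ f t4 = (0, 0, 1, 0).
  by rewrite /f ay4 by4 cy4 dy4 at4 bt4 ct4 dt4.
have fE := (fy1, ft1, fy2, ft2, fy3, ft3, fy4, ft4).
pose s := [:: y1; t1; y2; t2; y3; t3; y4; t4].
have sL : {subset s <= L8}.
  by apply/allP; rewrite /= y1L t1L y2L t2L y3L t3L y4L t4L.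
have sH : {in s, forall l, inter H l = 0}.
  move=> x xs; have /L8P[_ xK] := sL x xs.
  have fx : (f x).1.1.1 + (f x).1.1.2 + (f x).1.2 + (f x).2 = 1.
    move: xs; rewrite !inE.
    by do !case/predU1P => [->|]; rewrite ?fE // => /eqP ->; rewrite fE.
  by rewrite /H interDl (interC K) xK eD 3!interDl fx.
have us : uniq s.
  have neq x y : f x != f y -> x != y by apply: contraNneq => ->.
  by rewrite /= !inE !negb_or n1 n2 n3 n4 !neq ?fE.
have -> : 3 *: D + 4 *: K = \sum_(l <- s) l.
  rewrite !big_cons big_nil addr0 (addrA y1) e1 (addrA y2) e2 (addrA y3) e3 e4.
  by rewrite eD; apply/rowP => j; move: K => k; rewrite !mxE; ring.
exact: (skew_line_orthogonal HH HK us sL sH).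
Qed.

Theorem corollary8 (A : {fset Pic}) (D : Pic)
    (hA : A_polytope 3 A) (hD : D = center A) :
  skew_line 8 (3 *: D + 4 *: K) <-> uncornered A.
Proof.
case: hA => cardA AL A1.
have [a [b [c [d eA]]]] : exists a b c d, A = [:: a; b; c; d] :> seq Pic.
  case: (A : seq Pic) cardA => [|a [|b [|c [|d [|? ?]]]]] //= _.
  by exists a, b, c, d.
have memA l : (l \in A) = (l \in [:: a; b; c; d]) by rewrite -eA.
have [aA bA cA dA] : [/\ a \in A, b \in A, c \in A & d \in A].
  by rewrite !memA !inE !eqxx !orbT.
have [aL bL cL dL] := And4 (AL a aA) (AL b bA) (AL c cA) (AL d dA).
have := fset_uniq A; rewrite eA /= !inE !negb_or andbT.
case/and3P=> /and3P[ne_ab ne_ac ne_ad] /andP[ne_bc ne_bd] ne_cd.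
have ab := A1 a b aA bA ne_ab; have ac := A1 a c aA cA ne_ac.
have ad := A1 a d aA dA ne_ad; have bc := A1 b c bA cA ne_bc.
have bd := A1 b d bA dA ne_bd; have cd := A1 c d cA dA ne_cd.
have eD : D = a + b + c + d by rewrite hD /center eA !big_cons big_nil addr0 !addrA.
have [DD DK] : inter D D = 8 /\ inter D K = - 4.
  by rewrite eD; exact: inter_center.
have cornerP l : l \in L8 -> inter a l = 0 -> inter b l = 0 -> inter c l = 0 ->
    inter d l = 0 -> cornered A.
  move=> lL al bl cl dl; exists l => // x; rewrite memA => xA.
  apply/andP; move: xA; rewrite !inE.
  by case/or4P=> /eqP ->; rewrite ?al ?bl ?cl ?dl.
split.
- case=> B [cardB BL B0 eB] [l lL Al].
  have Al0 x : x \in A -> inter x l = 0 by move=> /Al /andP[_ /eqP].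
  have eD2 : D = 2 *: l - 2 *: K.
    by apply: (center_of_cornered DD DK lL); rewrite eD !interDl !Al0.
  have [m mB] : exists m, m \in B by apply/fset0Pn; rewrite -cardfs_gt0 cardB.
  have := inter_skew_line_summand BL B0 mB; rewrite -eB eD2.
  have /L8P[mm mK] := BL m mB.
  (* The sum of the eight lines is [6 l - 2 K], which meets [m] evenly. *)
  by clear -mm mK; inter_lia.
move=> unc; rewrite eD; apply: skew_line_center => // l lL al bl cl dl.
by apply: unc; exact: cornerP dl.
Qed.
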